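(* Let $p$ be an odd prime, let $\mathbb{F}$ be a field containing a primitive $p$th root of unity $q$, let $m$ be an integer with $1\le m\le p-1$, and let $H=\mathbf{h}(q,m)$ be the Book Hopf algebra generated by $a,x,y$ presented in the context. Suppose $H$ acts on a matrix algebra $A$ over $\mathbb{F}$. The action is inner, via a convolution invertible map $u:H\to A$, so that for all $b\in A$ $$a*b=u(a)bu(a)^{-1},\quad x*b=u(x)bu(a)^{-1}-bu(x)u(a)^{-1},\quad y*b=u(y)b-u(a)^{m}bu(a)^{-m}u(y),$$ and the elements $u(a),u(x),u(y)\in A$ in these formulas can be chosen so that $$u(a)^p=\theta1,\quad u(a)u(x)=q\,u(x)u(a),\quad u(a)u(y)=q^m u(y)u(a),$$ $$u(x)^p=\mu1,\quad u(y)^p=\nu1,\quad u(x)u(y)-u(y)u(x)=\tau u(a)^m,$$ for some $\theta,\tau,\mu,\nu\in\mathbb{F}$ with $\theta\ne0$.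
   Context: The Book Hopf algebra $\mathbf{h}(q,m)$ is generated by $a,x,y$ with relations $axa^{-1}=qx$, $aya^{-1}=q^my$, $a^p=1$, $x^p=0$, $y^p=0$, $xy-yx=0$, and coproduct $\Delta(a)=a\otimes a$, $\Delta(x)=x\otimes a+1\otimes x$, $\Delta(y)=y\otimes1+a^m\otimes y$. An action of $H$ on $A$ is an $H$-module algebra structure $(h,b)\mapsto h*b$; it is inner via a convolution invertible linear map $u:H\to A$ with $u(1)=1_A$ if $h*b=\sum u(h_{(1)})bu^{-1}(h_{(2)})$, $u^{-1}$ being the convolution inverse. *)

(* Defs.v *)
From HB Require Import structures.
From mathcomp Require Import all_boot all_order all_algebra.

Set Implicit Arguments.
Unset Strict Implicit.
Unset Printing Implicit Defensive.

Import GRing.Theory.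
Local Open Scope ring_scope.

(* An element of a tensor product is represented by a formal sum of pure
   tensors: the sequence [:: (x1, y1); ...; (xn, yn)] stands for
   x1 (x) y1 + ... + xn (x) yn.  By the universal property of H (x) K, two
   such sums are equal in H (x) K iff no bilinear map separates them. *)
Definition tensor_eq (F : fieldType) (H K : lmodType F) (s t : seq (H * K)) :=
  forall (V : lmodType F) (f : {bilinear H -> K -> V}),
    \sum_(z <- s) f z.1 z.2 = \sum_(z <- t) f z.1 z.2.

Definition trilinear (F : fieldType) (H V : lmodType F)
    (f : H -> H -> H -> V) :=
  [/\ forall y z, linear (fun x => f x y z),
      forall x z, linear (fun y => f x y z) &
      forall x y, linear (fun z => f x y z)].

(* The coproduct chooses, for each h, a representing sum of h_(1) (x) h_(2);
   a Sweedler sum f(h_(1), h_(2)) is \sum_(z <- coprod h) f z.1 z.2.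
   All the axioms on coprod are identities in tensor powers of H. *)
Record hopf (F : fieldType) (H : algType F) := Hopf {
  coprod : H -> seq (H * H);
  counit : {lrmorphism H -> F | *%R};
  antipode : {linear H -> H};
  coprod_linear : forall (k : F) (g h : H),
    tensor_eq (coprod (k *: g + h))
      ([seq (k *: z.1, z.2) | z <- coprod g] ++ coprod h);
  coprod1 : tensor_eq (coprod 1) [:: (1, 1)];
  coprodM : forall g h : H,
    tensor_eq (coprod (g * h))
      [seq (s.1 * t.1, s.2 * t.2) | s <- coprod g, t <- coprod h];
  coprodA : forall (V : lmodType F) (f : H -> H -> H -> V), trilinear f ->
    forall h : H,
      \sum_(z <- coprod h) \sum_(w <- coprod z.1) f w.1 w.2 z.2 =
      \sum_(z <- coprod h) \sum_(w <- coprod z.2) f z.1 w.1 w.2;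
  counitl : forall h : H, \sum_(z <- coprod h) counit z.1 *: z.2 = h;
  counitr : forall h : H, \sum_(z <- coprod h) counit z.2 *: z.1 = h;
  antipodel : forall h : H,
    \sum_(z <- coprod h) antipode z.1 * z.2 = counit h *: 1;
  antipoder : forall h : H,
    \sum_(z <- coprod h) z.1 * antipode z.2 = counit h *: 1
}.

(* As a ^+ p = 1, the inverse of a is a ^+ p.-1. *)
Definition book_relations (F : fieldType) (p : nat) (q : F) (m : nat)
    (B : algType F) (a x y : B) : Prop :=
  [/\ a * x * a ^+ p.-1 = q *: x, a * y * a ^+ p.-1 = q ^+ m *: y
    & [/\ a ^+ p = 1, x ^+ p = 0, y ^+ p = 0 & x * y - y * x = 0]].

(* The algebra H is presented by generators a, x, y and the above relations:
   it is universal among the algebras with three elements satisfying them. *)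
Definition book_presentation (F : fieldType) (p : nat) (q : F) (m : nat)
    (H : algType F) (a x y : H) : Prop :=
  [/\ book_relations p q m a x y,
      forall (B : algType F) (a' x' y' : B), book_relations p q m a' x' y' ->
        exists f : {lrmorphism H -> B}, [/\ f a = a', f x = x' & f y = y']
    & forall (B : algType F) (f g : {lrmorphism H -> B}),
        f a = g a -> f x = g x -> f y = g y -> f =1 g].

(* The Hopf algebra (H, hH), with generators a, x, y, is h(q, m). *)
Definition book_hopf (F : fieldType) (p : nat) (q : F) (m : nat)
    (H : algType F) (hH : hopf H) (a x y : H) : Prop :=
  book_presentation p q m a x y /\
  [/\ tensor_eq (coprod hH a) [:: (a, a)],
      tensor_eq (coprod hH x) [:: (x, a); (1, x)]
    & tensor_eq (coprod hH y) [:: (y, 1); (a ^+ m, y)]].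

Section Actions.

Variables (F : fieldType) (H : algType F) (hH : hopf H) (A : algType F).

Definition module_algebra (act : {bilinear H -> A -> A}) : Prop :=
  [/\ forall b, act 1 b = b,
      forall g h b, act (g * h) b = act g (act h b),
      forall h, act h 1 = counit hH h *: 1
    & forall h b c,
        act h (b * c) = \sum_(z <- coprod hH h) act z.1 b * act z.2 c].

Definition conv (u v : H -> A) (h : H) : A :=
  \sum_(z <- coprod hH h) u z.1 * v z.2.

Definition conv_inverse (u v : H -> A) : Prop :=
  (forall h, conv u v h = counit hH h *: 1) /\
  (forall h, conv v u h = counit hH h *: 1).

Definition inner_via (act : H -> A -> A) (u : {linear H -> A}) : Prop :=
  u 1 = 1 /\
  exists v : {linear H -> A}, conv_inverse u v /\
    forall h b, act h b = \sum_(z <- coprod hH h) u z.1 * b * v z.2.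

End Actions.

(* Main.v *)
Require Import Defs.
From HB Require Import structures.
From mathcomp Require Import all_boot all_order all_algebra.
From mathcomp Require Import ring boolp.
Import GRing.Theory.
Local Open Scope ring_scope.

Set Implicit Arguments.
Unset Strict Implicit.

(* The generator [a] acts by an algebra automorphism, hence as conjugation by
   some [g]; then [(x * b) g] and [g^-m (y * b)] are derivations of the matrix
   algebra, hence inner, which yields [X] and [Y].  Adding a scalar to [X] and a
   multiple of [g ^+ m] to [Y] makes them q-commute with [g].  The remaining
   relations say that [a ^+ p - 1], [x ^+ p], [y ^+ p] and [x y - y x] act as
   zero: since left and right multiplication parts of the operators [x] and [y]
   q-commute, their [p]-th powers are given by the two extreme terms of the
   q-binomial formula, so [X ^+ p] and [Y ^+ p] are central.

   To find [u], start from any linear [u0] with [u0 (a ^+ i) = g ^+ i] for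
   [i < p], [u0 x = X] and [u0 y = Y] (small representations of the presented
   algebra show that one exists) and put
   [u h = \sum_k (h_(1) * e_{k0}) u0(h_(2)) e_{0k}].  Then
   [u h b = (h_(1) * b) u(h_(2))] for all [h] and [b], and [u] agrees with [u0]
   wherever [u0] already satisfied this.  Finally [u] is convolution invertible
   because its values at the powers of [a] are units: modulo these, it is
   unipotent for the grading in which [a] has degree 0 and [x], [y] degree 1. *)

(** * Linear and bilinear maps as bundled structures *)

Lemma linear_exists (F : fieldType) (U V : lmodType F) (f : U -> V) :
  linear f -> exists g : {linear U -> V}, g =1 f.
Proof.
move=> lf; pose m := GRing.isLinear.Build F U V *:%R f lf.
by exists (HB.pack_for {linear U -> V} f m).
Qed.

Lemma bilinear_exists (F : fieldType) (U U' V : lmodType F)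
    (f : U -> U' -> V) :
  (forall z, linear (f^~ z)) -> (forall z, linear (f z)) ->
  exists g : {bilinear U -> U' -> V}, forall y z, g y z = f y z.
Proof.
move=> lf rf.
pose m := bilinear_isBilinear.Build F U U' V *:%R *:%R f (lf, rf).
by exists (HB.pack_for {bilinear U -> U' -> V} f m).
Qed.

Section Linear.
Variables (F : fieldType) (U V : lmodType F) (f : U -> V).
Hypothesis lf : linear f.

Lemma linear_scale k v : f (k *: v) = k *: f v.
Proof. by have [g fg] := linear_exists lf; rewrite -!fg linearZ. Qed.

Lemma linear_zero : f 0 = 0.
Proof. by have [g fg] := linear_exists lf; rewrite -fg linear0. Qed.

Lemma linear_sum_seq (I : Type) (r : seq I) (k : I -> U) :
  f (\sum_(i <- r) k i) = \sum_(i <- r) f (k i).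
Proof.
have [g fg] := linear_exists lf; rewrite -fg linear_sum.
by apply: eq_bigr => i _; rewrite fg.
Qed.

End Linear.

(** * Central elements, derivations and automorphisms of a matrix algebra *)

Section MatrixAlgebra.
Variables (F : fieldType) (n : nat).
Local Notation M := 'M[F]_n.+1.
Implicit Types (b c g : M).

(** Compare the [(i, 0)] entries of [c e_{j0}] and [e_{j0} c]. *)
Lemma central_scalar c : (forall b, c * b = b * c) -> exists k, c = k%:M.
Proof.
move=> cC; exists (c 0 0); apply/matrixP=> i j; rewrite !mxE.
have /matrixP/(_ i 0) := cC (delta_mx j 0).
rewrite !mxE (bigD1 j) //= big1 => [|k /negPf nkj];
  last by rewrite mxE nkj mulr0.
rewrite (bigD1 0) //= big1 => [|k /negPf nk0];
  last by rewrite mxE nk0 andbF mul0r.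
rewrite !mxE !eqxx /= mulr1 !addr0 andbT => ->.
by case: eqP => _; rewrite ?mul1r ?mul0r ?mulr1n ?mulr0n.
Qed.

Lemma sum_delta_mx : \sum_k delta_mx k 0 * delta_mx 0 k = 1 :> M.
Proof.
transitivity (\sum_k delta_mx k k : M).
  by apply: eq_bigr => k _; rewrite -[_ * _]/(_ *m _) mul_delta_mx.
by rewrite -mx1_sum_delta.
Qed.

(* [\sum_k e_{k0} (x) e_{0k}] is a Casimir element: multiplying it by [b] on
   the left or on the right has the same effect. *)
Lemma casimir (f : M -> M) b c : linear f ->
  \sum_k f (b * delta_mx k 0) * (c * delta_mx 0 k) =
  (\sum_k f (delta_mx k 0) * (c * delta_mx 0 k)) * b.
Proof.
move=> lf; have {lf} [g fg] := linear_exists lf.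
transitivity (\sum_k \sum_l b l k *: (g (delta_mx l 0) * (c * delta_mx 0 k))).
  apply: eq_bigr => k _.
  have -> : b * delta_mx k 0 = \sum_l b l k *: delta_mx l 0.
    rewrite {1}(matrix_sum_delta b) mulr_suml; apply: eq_bigr => l _.
    rewrite mulr_suml (bigD1 k) //= big1 => [|j njk].
      by rewrite addr0 -scalerAl -[_ * _]/(_ *m _) mul_delta_mx.
    by rewrite -scalerAl -[_ * _]/(_ *m _) mul_delta_mx_0 ?scaler0.
  rewrite -fg linear_sum mulr_suml; apply: eq_bigr => l _.
  by rewrite linearZ -scalerAl.
rewrite exchange_big mulr_suml; apply: eq_bigr => l _ /=.
rewrite -!mulrA.
have -> : delta_mx 0 l * b = \sum_k b l k *: delta_mx 0 k.
  rewrite {1}(matrix_sum_delta b) mulr_sumr (bigD1 l) //= [X in _ + X]big1 =>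
    [|i nli].
    rewrite addr0 mulr_sumr; apply: eq_bigr => k _.
    by rewrite -scalerAr -[_ * _]/(_ *m _) mul_delta_mx.
  rewrite mulr_sumr big1 // => k _.
  by rewrite -scalerAr -[_ * _]/(_ *m _) mul_delta_mx_0 ?scaler0 // eq_sym.
by rewrite !mulr_sumr fg; apply: eq_bigr => k _; rewrite -!scalerAr.
Qed.

(** For [X = \sum_k D(e_{k0}) e_{0k}] the Casimir identity gives [X b = \sum_k D(b e_{k0}) e_{0k}],
    which the Leibniz rule expands into [D b + b X]. The factor [1] in the witness matches the form
    of [casimir]. *)
Lemma derivation_inner (D : M -> M) : linear D ->
  (forall b c, D (b * c) = D b * c + b * D c) ->
  exists X, forall b, D b = X * b - b * X.
Proof.
move=> lD DM; exists (\sum_k D (delta_mx k 0) * (1 * delta_mx 0 k)) => b.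
rewrite -casimir // mulr_sumr -sumrB -[LHS]mulr1.
rewrite -[X in _ * X = _]sum_delta_mx mulr_sumr.
by apply: eq_bigr => k _; rewrite DM mul1r mulrDl [b *
  (_ * _)]mulrA addrK mulrA.
Qed.

Lemma nonunit_annihilator g :
  g \isn't a GRing.unit -> exists2 w : M, w != 0 & g * w = 0.
Proof.
rewrite -[_ \is a _]/(g \in unitmx) => gN.
exists (cokermx g); last exact: mulmx_coker.
apply: contra gN => /eqP c0.
by rewrite -row_full_unit -sub1mx submxE c0 mulmx0.
Qed.

(** For a matrix unit [b], an entry of [g * b * w] is an arbitrary entry of [g] times a fixed
    nonzero entry of [w]. *)
Lemma mx_prime g w : w != 0 -> (forall b, g * b * w = 0) -> g = 0.
Proof.
move=> w0 gw.
have [i [j wij]] := matrix0Pn _ w0.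
apply/matrixP=> r s; have /matrixP/(_ r j) := gw (delta_mx s i).
rewrite mxE (bigD1 i) //= big1 => [|k nki]; last first.
  by rewrite mxE big1 ?mul0r // => l _; rewrite mxE (negPf nki) andbF mulr0.
rewrite mxE (bigD1 s) //= big1 => [|k nks]; last first.
  by rewrite mxE (negPf nks) mulr0.
rewrite !mxE !eqxx mulr1 !addr0 => /eqP.
by rewrite mulf_eq0 (negPf wij) orbF => /eqP.
Qed.

(** Skolem-Noether. By the Casimir identity each [G c] intertwines [b] with [phi b]. Some
    [G (delta_mx i 0)] is nonzero, as otherwise [phi 1 = 0]; if it killed a nonzero [w], then it
    would satisfy [G b w = phi(b) G w = 0] for all [b], against primeness. *)
Lemma automorphism_inner (phi : M -> M) : linear phi -> phi 1 = 1 ->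
    (forall b c, phi (b * c) = phi b * phi c) ->
  exists2 g, g \is a GRing.unit & forall b, phi b = g * b * g^-1.
Proof.
move=> lphi phi1 phiM.
pose G c : M := \sum_k phi (delta_mx k 0) * (c * delta_mx 0 k).
have GC c b : G c * b = phi b * G c.
  rewrite /G -casimir // mulr_sumr.
  by apply: eq_bigr => k _; rewrite phiM !mulrA.
have [i Gi] : exists i, G (delta_mx i 0) != 0.
  apply/existsP; apply: contraT => /existsPn G0.
  (* The [(r, 0)] entry of [G (delta_mx i 0)] is the [(r, i)] entry of [phi (delta_mx 0 0)]. *)
  have phi00 : phi (delta_mx 0 0) = 0.
    apply/matrixP=> r i; rewrite [RHS]mxE.
    have /negPn/eqP/matrixP/(_ r 0) := G0 i.
    rewrite summxE (bigD1 0) //= big1 => [|k /negPf nk0].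
      rewrite addr0 -[delta_mx i 0 * _]/(_ *m _) mul_delta_mx mxE.
      rewrite (bigD1 i) //= big1 => [|l /negPf nli].
        by rewrite !mxE !eqxx mulr1 addr0.
      by rewrite !mxE nli mulr0.
    rewrite -[delta_mx i 0 * _]/(_ *m _) mul_delta_mx mxE big1 // => l _.
    by rewrite !mxE (eq_sym 0) nk0 andbF mulr0.
  have phi0 b : phi (b * delta_mx 0 0) = 0 by rewrite phiM phi00 mulr0.
  have: phi 1 != 0 by rewrite phi1 oner_neq0.
  rewrite -sum_delta_mx linear_sum_seq // big1 ?eqxx // => k _.
  have -> : delta_mx k 0 = delta_mx k 0 * delta_mx 0 0 :> M.
    by rewrite -[_ * _]/(_ *m _) mul_delta_mx.
  by rewrite phiM phi0 mul0r.
suff Gunit : G (delta_mx i 0) \is a GRing.unit.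
  by exists (G (delta_mx i 0)) => // b; rewrite GC mulrK.
apply: contraT => /nonunit_annihilator[w w0 Gw]; case/negP: Gi.
apply/eqP; apply: (mx_prime w0) => b.
by rewrite GC -mulrA Gw mulr0.
Qed.

End MatrixAlgebra.

(** * Gaussian binomials and q-commuting operators *)

(** The q-Pascal recursion stays meaningful at roots of unity, where the quotient of q-factorials
    can become 0/0. *)
Fixpoint gauss_binomial (F : fieldType) (q : F) (n j : nat) : F :=
  match n, j with
  | _, 0 => 1
  | 0, _.+1 => 0
  | n'.+1, j'.+1 =>
      gauss_binomial q n' j' + q ^+ j'.+1 * gauss_binomial q n' j'.+1
  end.

Section GaussBinomial.
Variables (F : fieldType) (q : F).
Local Notation qbin := (gauss_binomial q).

Lemma gauss_binomial0 n : qbin n 0 = 1. Proof. by case: n. Qed.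

Lemma gauss_binomial_small n j : (n < j)%N -> qbin n j = 0.
Proof.
elim: n j => [|n IH] [|j] //= nj; rewrite !IH ?mulr0 ?addr0 //.
exact: ltnW.
Qed.

Lemma gauss_binomialn n : qbin n n = 1.
Proof.
by elim: n => //= n ->; rewrite gauss_binomial_small // mulr0 addr0.
Qed.

(* The factor [q ^+ j] avoids the truncated subtraction in [q ^+ (n - j)]. *)
Lemma mul_gauss_binomial n j :
  q ^+ j * ((1 - q ^+ j.+1) * qbin n j.+1) = (q ^+ j - q ^+ n) * qbin n j.
Proof.
elim: n j => [|n IH] [|j] /=; rewrite ?subrr ?mulr0 ?mul0r //.
  have := IH 0%N; rewrite gauss_binomial0 !expr0 !mul1r mulr1 expr1 exprS.
  move=> E; transitivity (1 - q + q * ((1 - q) * qbin n 1)); first by ring.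
  by rewrite E; ring.
have := IH j.+1; have := IH j; rewrite !exprS.
set c := qbin n j; set c1 := qbin n j.+1; set c2 := qbin n j.+2.
set x := q ^+ j; set y := q ^+ n => E1 E2.
transitivity (q * x * (1 - q * (q * x)) * c1
  + q * (q * x) * (q * x * ((1 - q * (q * x)) * c2))); first by ring.
rewrite E2.
transitivity (q * ((x - y) * c) + (q * x - q * y) * (q * x) * c1); last by ring.
by rewrite -E1; ring.
Qed.

(** Since [q ^+ n = 1], the recursion in [j] has right-hand side [(q ^+ j - 1) * qbin n j], which is
    zero for [j = 0] and then inductively, while [1 - q ^+ j.+1] is nonzero as long as
    [j.+1 < n]. *)
Lemma gauss_binomial_prim n j : n.-primitive_root q ->
  (0 < j < n)%N -> qbin n j = 0.
Proof.
move=> q_prim; have q0 : q != 0.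
  by rewrite (prim_root_eq0 q_prim) -lt0n (prim_order_gt0 q_prim).
elim: j => // j IH /andP[_ jn].
have := mul_gauss_binomial n j; rewrite (prim_expr_order q_prim).
have -> : (q ^+ j - 1) * qbin n j = 0.
  case: (posnP j) => [-> | j0]; first by rewrite expr0 subrr mul0r.
  by rewrite IH ?mulr0 // j0 ltnW.
move/eqP; rewrite !mulf_eq0 expf_eq0 (negPf q0) andbF /= subr_eq0 eq_sym.
by rewrite -(prim_order_dvd q_prim) gtnNdvd //= => /eqP.
Qed.

End GaussBinomial.

Section QCommuting.
Variables (F : fieldType) (q : F) (V : lmodType F) (A B : {linear V -> V}).
Hypothesis AB : forall v, A (B v) = q *: B (A v).

Lemma iter_qcommute j v : A (iter j B v) = q ^+ j *: iter j B (A v).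
Proof.
elim: j => [|j IH] /=; first by rewrite scale1r.
by rewrite AB IH linearZ scalerA exprS.
Qed.

Lemma qbinomial_expansion n v :
  iter n (fun w => A w + B w) v =
  \sum_(j < n.+1) gauss_binomial q n j *: iter j B (iter (n - j) A v).
Proof.
elim: n => [|n IH]; first by rewrite big_ord1 scale1r.
rewrite iterS IH !linear_sum [in RHS]big_ord_recl.
rewrite [X in X + _ = _]big_ord_recl -addrA.
rewrite !gauss_binomial0 !scale1r !subn0; congr (_ + _).
rewrite [X in _ + X = _]big_ord_recr [in RHS]big_ord_recr /=.
rewrite addrA -big_split /= /bump /= !add0n !add1n subSS.
rewrite (gauss_binomial_small q (ltnSn n)) mulr0 addr0 linearZ.
congr (_ + _); apply: eq_bigr => j _.
rewrite !add0n !add1n subSS scalerDl addrC !linearZ /=; congr (_ + _).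
rewrite AB iter_qcommute !linearZ /= !scalerA exprS mulrC.
rewrite (_ : A (iter _ A v) = iter (n - j) A v) //.
by rewrite -iterS -subSn.
Qed.

Lemma iter_qcommute_prim n v : n.-primitive_root q ->
  iter n (fun w => A w + B w) v = iter n A v + iter n B v.
Proof.
move=> q_prim; rewrite qbinomial_expansion; have := prim_order_gt0 q_prim.
case: n q_prim => // n q_prim _.
rewrite big_ord_recl big_ord_recr big1 => [|j _]; last first.
  by rewrite gauss_binomial_prim ?scale0r //= ltnS ltn_ord.
rewrite /= /bump /= !add0n add1n subnn gauss_binomialn
  (gauss_binomial_small q (ltnSn n)).
by rewrite mulr0 addr0 !scale1r add0r.
Qed.

End QCommuting.

(** * Elements implementing the action of the generators *)

Definition sandwich (F : fieldType) (A : algType F) (c d b : A) := c * b * d.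

Fact sandwich_linear (F : fieldType) (A : algType F) (c d : A) :
  linear (sandwich c d).
Proof. by move=> k b b'; rewrite /sandwich mulrDr mulrDl -scalerAr -scalerAl.
  Qed.

HB.instance Definition _ (F : fieldType) (A : algType F) (c d : A) :=
  GRing.isLinear.Build F A A *:%R (sandwich c d) (sandwich_linear c d).

Lemma iter_sandwich (F : fieldType) (A : algType F) (c d b : A) k :
  iter k (sandwich c d) b = sandwich (c ^+ k) (d ^+ k) b.
Proof.
elim: k => [|k IH]; first by rewrite /sandwich mul1r mulr1.
by rewrite iterS IH /sandwich exprS exprSr !mulrA.
Qed.

Section Relations.
Variables (F : fieldType) (A : unitAlgType F) (p : nat) (q : F) (g : A).
Hypotheses (p_odd : odd p) (q_prim : p.-primitive_root q).
Hypothesis gU : g \is a GRing.unit.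

Let signp (b : A) : (- b) ^+ p = - b ^+ p.
Proof. by rewrite exprNn -signr_odd p_odd mulN1r. Qed.

(** The summands [b |-> X b g^-1] and [b |-> - b X g^-1] q-commute, so the vanishing of the [p]-th
    power reads [X^p b g^-p = b (X g^-1)^p], the sign coming from [p] odd. The case [b = 1]
    identifies [(X g^-1)^p] with [X^p g^-p]. *)
Lemma skew_commutatorr_power (X : A) : g * X = q *: (X * g) ->
    (forall b, iter p (fun b => X * b * g^-1 - b * X * g^-1) b = 0) ->
  forall b, X ^+ p * b = b * X ^+ p.
Proof.
move=> gX Xp b.
have Xg : X * g^-1 = q *: (g^-1 * X).
  apply: (mulrI gU); apply: (mulIr gU).
  by rewrite mulrA mulrVK // gX -scalerAr mulVKr // -scalerAl.
have E c : X ^+ p * c * g^-1 ^+ p = c * (X * g^-1) ^+ p.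
  apply/eqP; rewrite -subr_eq0 -[X in _ == X](Xp c); apply/eqP.
  transitivity (iter p (fun b => sandwich X g^-1 b + sandwich (-1)
    (X * g^-1) b) c).
    rewrite (iter_qcommute_prim _ _ q_prim) => [|v].
      by rewrite /= !iter_sandwich /sandwich signp expr1n mulN1r mulNr.
    rewrite /= /sandwich !mulN1r !mulNr !mulrN !mulNr scalerN -!mulrA.
    have -> : X * (g^-1 * g^-1) = q *: (g^-1 * (X * g^-1)).
      by rewrite mulrA {1}Xg -scalerAl mulrA.
    by rewrite -!scalerAr.
  by apply: eq_iter => v; rewrite /sandwich mulN1r mulNr mulrA.
apply: (mulIr (unitrX p (etrans (unitrV _) gU))).
by rewrite E -mulrA; have := E 1; rewrite mulr1 mul1r => ->.
Qed.

(** Likewise [b |-> - h b h^-1 Y] and [b |-> Y b] q-commute, whence [Y^p b = h^p b (h^-1 Y)^p];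
    centrality of [h^p] then lets [b] move to the front. *)
Lemma skew_commutatorl_power (h Y : A) : h \is a GRing.unit ->
    (forall b, h ^+ p * b = b * h ^+ p) -> h * Y = q *: (Y * h) ->
    (forall b, iter p (fun b => Y * b - h * b * h^-1 * Y) b = 0) ->
  forall b, Y ^+ p * b = b * Y ^+ p.
Proof.
move=> hU hp hY Yp b.
have E c : Y ^+ p * c = h ^+ p * c * (h^-1 * Y) ^+ p.
  apply/eqP; rewrite -subr_eq0 addrC -[X in _ == X](Yp c); apply/eqP.
  transitivity (iter p (fun b => sandwich (- h)
    (h^-1 * Y) b + sandwich Y 1 b) c).
    rewrite (iter_qcommute_prim _ _ q_prim) => [|v].
      by rewrite /= !iter_sandwich /sandwich signp expr1n mulr1 !mulNr.
    by rewrite /= /sandwich !mulr1 !mulNr !mulrN scalerN !mulrA hY -!scalerAl.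
  by apply: eq_iter => v; rewrite /sandwich mulr1 !mulNr addrC !mulrA.
by rewrite E hp -mulrA -[Y ^+ p]mulr1 E mulr1.
Qed.

(** Put [N = h b h^-1]. Moving [g] past [Y] and [h] past [X] costs the same factor [r], so the mixed
    terms [Y b X] and [X N Y] agree on both sides and cancel. What is left is
    [(X Y - Y X) b = N (X Y - Y X)]. *)
Lemma skew_commutators (h X Y : A) (r : F) : r != 0 -> h \is a GRing.unit ->
    g * Y = r *: (Y * g) -> h * X = r *: (X * h) -> g * h = h * g ->
    (forall b, X * (Y * b - h * b * h^-1 * Y) * g^-1
               - (Y * b - h * b * h^-1 * Y) * X * g^-1 =
               Y * (X * b * g^-1 - b * X * g^-1)
               - h * (X * b * g^-1 - b * X * g^-1) * h^-1 * Y) ->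
  forall b, h^-1 * (X * Y - Y * X) * b = b * (h^-1 * (X * Y - Y * X)).
Proof.
move=> r0 hU gY hX gh XY b.
have gVh : g^-1 * h^-1 = h^-1 * g^-1 by rewrite -!invrM // gh.
have gVY : g^-1 * h^-1 * Y * g = r^-1 *: (h^-1 * Y).
  rewrite gVh -!mulrA; apply: (canRL (scalerK r0)).
  by rewrite 2!scalerAr -gY mulKr.
have hX' : r^-1 *: (h * X) = X * h by rewrite hX scalerA mulVf // scale1r.
have Xh : r^-1 *: (X * h^-1) = h^-1 * X.
  apply: (mulrI hU); apply: (mulIr hU).
  by rewrite -scalerAr mulVKr // mulrA -scalerAl mulrVK // hX'.
set P := X * Y; set Q := Y * X; set N := h * b * h^-1.
have E : P * b - Y * b * X - (X * N * Y - N * Q) =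
         Q * b - Y * b * X - (X * N * Y - N * P).
  have := XY b; rewrite -/N -!(mulrBl g^-1).
  move/(congr1 ( *%R^~ g)); rewrite mulrVK // [X in _ = X]mulrBl.
  have -> : Y * ((X * b - b * X) * g^-1) * g = Q * b - Y * b * X.
    by rewrite -!mulrA mulVr // mulr1 mulrBr !mulrA.
  have -> : h * ((X * b - b * X) * g^-1) * h^-1 * Y * g = X * N * Y - N * P.
    transitivity (h * (X * b - b * X) * (g^-1 * h^-1 * Y * g)).
      by rewrite !mulrA.
    rewrite gVY -scalerAr scalerAl mulrBr scalerBr mulrBl; congr (_ - _).
      by rewrite (mulrA h X b) scalerAl hX' /N !mulrA.
    transitivity (h * b * (r^-1 *: (X * h^-1)) * Y);
      last by rewrite Xh /N /P !mulrA.
    by rewrite -scalerAr -!scalerAl !mulrA.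
  move=> <-; rewrite mulrBr mulrBl !opprB /P /Q !mulrA.
  by rewrite addrACA [RHS]addrACA [- (Y * b * X) - _]addrC.
have {E} E : P * b + N * Q = Q * b + N * P.
  move: E; rewrite !opprB !addrA.
  rewrite ![_ - Y * b * X]addrC -!addrA => /addrI.
  rewrite ![_ + (_ - X * N * Y)]addrA => /addIr.
  by [].
rewrite -mulrA mulrBl.
have -> : P * b - Q * b = N * (P - Q).
  apply/eqP; rewrite subr_eq mulrBr addrAC (addrC (N * P)) -E addrK //.
by rewrite /N -!mulrA mulKr.
Qed.

End Relations.

Section Implementers.
Variables (F : fieldType) (n : nat).
Local Notation M := 'M[F]_n.+1.
Variables (g : M) (phi : M -> M).
Hypotheses (gU : g \is a GRing.unit) (phiE : forall b, phi b = g * b * g^-1).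

(** The hypothesis makes [g X g^-1 - q X] central, hence a scalar [k]; shifting [X] by a scalar [t]
    then works when [k + t = q t]. *)
Lemma qcommute_shift (q : F) (X : M) : q != 1 ->
    (forall b, g * (X * b - b * X) * g^-1 = q *: (X * phi b - phi b * X)) ->
  exists k : F, g * (X + k%:A) = q *: ((X + k%:A) * g).
Proof.
move=> q1 gX; have [k Ek] : exists k, g * X * g^-1 - q *: X = k%:M.
  apply: central_scalar => b; apply/eqP.
  have := gX (g^-1 * b * g); rewrite phiE !mulrA mulrV // mul1r mulrK //.
  rewrite mulrBr mulrBl !mulrA mulrV // mul1r => /eqP.
  rewrite !mulrK // subr_eq => /eqP E.
  rewrite mulrBl E mulrBr -scalerAl -scalerAr scalerBr.
  by rewrite addrC addrA addKr addrC !mulrA.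
have {}gX : g * X = q *: (X * g) + k *: g.
  have /eqP := Ek; rewrite subr_eq => /eqP/(congr1 ( *%R^~ g)).
  by rewrite mulrVK // mulrDl -scalemx1 -!scalerAl mul1r addrC.
exists (k / (q - 1)).
rewrite mulrDl mulrDr mulr_algl mulr_algr gX scalerDr -addrA; congr (_ + _).
rewrite -scalerDl scalerA; congr (_ *: _).
by field; rewrite subr_eq0.
Qed.

Lemma skew_derivationr_inner (q : F) (D : M -> M) : linear D -> q != 1 ->
    (forall b c, D (b * c) = D b * phi c + b * D c) ->
    (forall b, phi (D b) = q *: D (phi b)) ->
  exists2 X, forall b, D b = X * b * g^-1 - b * X * g^-1
           & g * X = q *: (X * g).
Proof.
move=> lD q1 DM Dphi.
have [|b c|X0 DX] := @derivation_inner _ _ (fun b => D b * g).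
- by move=> k b c; rewrite lD mulrDl scalerAl.
- by rewrite DM phiE mulrDl -!mulrA mulVr // mulr1.
have DE b : D b = (X0 * b - b * X0) * g^-1 by rewrite -DX mulrK.
have [b|k gX] := @qcommute_shift q X0 q1.
  have := Dphi b; rewrite !DE scalerAl {1}phiE mulrA.
  exact: (mulIr (etrans (unitrV _) gU)).
exists (X0 + k%:A) => // b; rewrite DE -mulrBl; congr (_ * _).
by rewrite mulrDl mulrDr mulr_algl mulr_algr opprD addrACA subrr addr0.
Qed.

Lemma skew_derivationl_inner (q : F) (h : M) (D : M -> M) :
    linear D -> h \is a GRing.unit -> g * h = h * g -> q != 1 ->
    (forall b c, D (b * c) = D b * c + h * b * h^-1 * D c) ->
    (forall b, phi (D b) = q *: D (phi b)) ->
  exists2 Y, forall b, D b = Y * b - h * b * h^-1 * Y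
           & g * Y = q *: (Y * g).
Proof.
move=> lD hU gh q1 DM Dphi.
have [|b c|Z DZ] := @derivation_inner _ _ (fun b => h^-1 * D b).
- by move=> k b c; rewrite lD mulrDr scalerAr.
- by rewrite DM mulrDr !mulrA mulVr // mul1r.
have DE b : D b = h * (Z * b - b * Z) by rewrite -DZ mulVKr.
have [b|k gZ] := @qcommute_shift q Z q1.
  have := Dphi b; rewrite !DE scalerAr {1}phiE mulrA gh -!mulrA.
  exact: (mulrI hU).
exists (h * (Z + k%:A)) => [b|].
  rewrite DE -!mulrA mulKr // -mulrBr; congr (_ * _).
  by rewrite mulrDl mulrDr mulr_algl mulr_algr opprD addrACA subrr addr0.
by rewrite mulrA gh -!mulrA scalerAr gZ.
Qed.

End Implementers.

(** * Sweedler sums and convolution *)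

Section Sweedler.
Variables (F : fieldType) (H : algType F) (hH : hopf H).
Implicit Types (V : lmodType F) (h : H).

Definition is_bilinear V (f : H -> H -> V) :=
  (forall z, linear (f^~ z)) /\ (forall z, linear (f z)).

Definition sweedler V (f : H -> H -> V) h := \sum_(z <- coprod hH h) f z.1 z.2.

Lemma sweedler_eq V (f : H -> H -> V) h t : is_bilinear f ->
  tensor_eq (coprod hH h) t -> sweedler f h = \sum_(z <- t) f z.1 z.2.
Proof.
case=> lf rf ht; have [g fg] := bilinear_exists lf rf.
transitivity (\sum_(z <- coprod hH h) g z.1 z.2).
  by apply: eq_bigr => z _; rewrite fg.
by rewrite ht; apply: eq_bigr => z _; rewrite fg.
Qed.

Lemma sweedler_linear V (f : H -> H -> V) : is_bilinear f ->
  linear (sweedler f).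
Proof.
move=> bf k g h; rewrite (sweedler_eq bf (coprod_linear hH k g h)).
rewrite big_cat big_map /= scaler_sumr; congr (_ + _).
by apply: eq_bigr => z _; rewrite (linear_scale (bf.1 z.2)).
Qed.

Lemma sweedler1 V (f : H -> H -> V) : is_bilinear f -> sweedler f 1 = f 1 1.
Proof. by move=> bf; rewrite (sweedler_eq bf (coprod1 hH)) big_seq1. Qed.

Lemma sweedlerM V (f : H -> H -> V) g h : is_bilinear f ->
  sweedler f (g * h) =
  sweedler (fun s1 s2 => sweedler (fun t1 t2 => f (s1 * t1) (s2 * t2)) h) g.
Proof.
by move=> bf; rewrite (sweedler_eq bf (coprodM hH g h)) big_allpairs_dep.
Qed.

Lemma sweedlerMl V (f : H -> H -> V) h : is_bilinear f ->
  is_bilinear (fun s1 s2 => sweedler (fun t1 t2 => f (s1 * t1) (s2 * t2)) h).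
Proof.
case=> lf rf; split=> z k s s'; rewrite /sweedler scaler_sumr -big_split /=.
  by apply: eq_bigr => t _; rewrite mulrDl -scalerAl lf.
by apply: eq_bigr => t _; rewrite mulrDl -scalerAl rf.
Qed.

Lemma is_bilinear_mul V (f : H -> H -> V) s t : is_bilinear f ->
  is_bilinear (fun s' t' => f (s * s') (t * t')).
Proof.
case=> lf rf; split=> z k g h.
  by rewrite mulrDr -scalerAr lf.
by rewrite mulrDr -scalerAr rf.
Qed.

Section Convolution.
Variable A : algType F.
Implicit Types u v w : H -> A.

Lemma conv_sweedler u v h : conv hH u v h = sweedler (fun s t => u s * v t) h.
Proof. by []. Qed.

Lemma conv_bilinear u v : linear u -> linear v ->
  is_bilinear (fun s t => u s * v t).
Proof.
move=> lu lv; split=> z k s t.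
  by rewrite lu mulrDl scalerAl.
by rewrite lv mulrDr scalerAr.
Qed.

Lemma conv_linear u v : linear u -> linear v -> linear (conv hH u v).
Proof. by move=> lu lv; exact: sweedler_linear (conv_bilinear lu lv). Qed.

Lemma convA u v w : linear u -> linear v -> linear w ->
  conv hH (conv hH u v) w =1 conv hH u (conv hH v w).
Proof.
move=> lu lv lw h; rewrite /conv.
transitivity (\sum_(z <- coprod hH h) \sum_(w0 <- coprod hH z.1)
                u w0.1 * v w0.2 * w z.2).
  by apply: eq_bigr => z _; rewrite mulr_suml.
rewrite (coprodA hH (f := fun s1 s2 s3 => u s1 * v s2 * w s3)).
  by apply: eq_bigr => z _; rewrite mulr_sumr; under eq_bigr do rewrite -mulrA.
split=> ? ? k s t.
- by rewrite lu !mulrDl -!scalerAl.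
- by rewrite lv mulrDr mulrDl -scalerAr -scalerAl.
- by rewrite lw mulrDr -scalerAr.
Qed.

Definition conv_unit h : A := counit hH h *: 1.

Lemma conv_unit_linear : linear conv_unit.
Proof. by move=> k g h; rewrite /conv_unit linearP scalerDl scalerA. Qed.

Lemma conv1u u : linear u -> conv hH conv_unit u =1 u.
Proof.
move=> lu h; rewrite -[in RHS](counitl hH h) linear_sum_seq //.
by apply: eq_bigr => z _; rewrite mulr_algl linear_scale.
Qed.

Lemma convu1 u : linear u -> conv hH u conv_unit =1 u.
Proof.
move=> lu h; rewrite -[in RHS](counitr hH h) linear_sum_seq //.
by apply: eq_bigr => z _; rewrite mulr_algr linear_scale.
Qed.

Lemma eq_conv u u' v v' : u =1 u' -> v =1 v' -> conv hH u v =1 conv hH u' v'.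
Proof. by move=> uu' vv' h; apply: eq_bigr => z _; rewrite uu' vv'. Qed.

End Convolution.

(** * Intertwiners for an action on a matrix algebra *)

Section ModuleAlgebra.
Variables (n : nat) (act : {bilinear H -> 'M[F]_n.+1 -> 'M[F]_n.+1}).
Hypothesis act_alg : module_algebra hH act.
Local Notation M := 'M[F]_n.+1.
Variable u0 : H -> M.
Hypothesis lu0 : linear u0.

Lemma actl_linear b : linear (act^~ b).
Proof. by move=> k g h; rewrite linearPl. Qed.

Lemma actr_linear h : linear (act h).
Proof. by move=> k b c; rewrite linearPr. Qed.

(* Compressing an arbitrary linear map with the Casimir element yields a
   solution of the intertwining relation, and fixes the values at which the
   relation already holds. *)
Definition intertwiner h : M :=
  \sum_k sweedler (fun s t => act s (delta_mx k 0) * (u0 t * delta_mx 0 k)) h.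

Let bil e e' : is_bilinear (fun s t => act s e * (u0 t * e')).
Proof.
split=> z k s t; first by rewrite actl_linear mulrDl scalerAl.
by rewrite lu0 mulrDl mulrDr -scalerAl -scalerAr.
Qed.

Lemma intertwiner_linear : linear intertwiner.
Proof.
move=> k g h; rewrite /intertwiner scaler_sumr -big_split;
  apply: eq_bigr => i _.
exact: sweedler_linear.
Qed.

(** The Casimir identity moves [b] inside the action, the module algebra axiom splits [h_(1)] over
    [b e_{k0}], and coassociativity regroups the three legs. *)
Lemma intertwinerE h b :
  intertwiner h * b = sweedler (fun s t => act s b * intertwiner t) h.
Proof.
have [_ _ _ actM] := act_alg.
transitivity (\sum_k \sum_(z <- coprod hH h) \sum_(w <- coprod hH z.1)
                act w.1 b * act w.2 (delta_mx k 0) * (u0 z.2 * delta_mx 0 k)).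
  rewrite /intertwiner /sweedler [X in X * b]exchange_big mulr_suml
    [RHS]exchange_big.
  apply: eq_bigr => z _.
  rewrite -casimir; last exact: actr_linear.
  by apply: eq_bigr => k _; rewrite actM mulr_suml.
rewrite /sweedler; under [RHS]eq_bigr do rewrite mulr_sumr.
rewrite [RHS]exchange_big; apply: eq_bigr => k _.
rewrite (coprodA hH (f := fun s t r =>
  act s b * act t (delta_mx k 0) * (u0 r * delta_mx 0 k))).
  by apply: eq_bigr => z _; rewrite mulr_sumr; under eq_bigr do rewrite -mulrA.
split=> ? ? l s t.
- by rewrite actl_linear !mulrDl -!scalerAl.
- by rewrite actl_linear mulrDr mulrDl -scalerAr -scalerAl.
- by rewrite lu0 mulrDl mulrDr -scalerAl -scalerAr.
Qed.

Lemma intertwiner_id h :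
    (forall b, u0 h * b = sweedler (fun s t => act s b * u0 t) h) ->
  intertwiner h = u0 h.
Proof.
move=> u0h; rewrite -[RHS]mulr1 -sum_delta_mx mulr_sumr.
apply: eq_bigr => k _; rewrite mulrA u0h mulr_suml.
by apply: eq_bigr => z _; rewrite mulrA.
Qed.

(** Insert [u(h_(2)) v(h_(3))], which is the counit, after [h_(1) * b] and apply the intertwining
    relation. *)
Lemma intertwiner_inner (u v : H -> M) : linear u -> linear v ->
    (forall h b, u h * b = sweedler (fun s t => act s b * u t) h) ->
    conv hH u v =1 @conv_unit M ->
  forall h b, act h b = \sum_(z <- coprod hH h) u z.1 * b * v z.2.
Proof.
move=> lu lv uE uv h b.
transitivity (conv hH (act^~ b) (conv hH u v) h).
  by rewrite (eq_conv (fun=> erefl) uv) convu1 //; apply: actl_linear.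
rewrite -convA //; last exact: actl_linear.
by apply: eq_bigr => z _; rewrite uE.
Qed.

End ModuleAlgebra.
End Sweedler.

(** * Maps out of the presented algebra *)

Section Subalgebra.
Variables (F : fieldType) (H : algType F) (P : H -> Prop).
Hypotheses (P1 : P 1) (PL : forall k g h, P g -> P h -> P (k *: g + h))
           (PM : forall g h, P g -> P h -> P (g * h)).

(** Subalgebra structures require a boolean predicate, obtained classically from the proposition
    [P]. *)
Definition subalg_pred : {pred H} := fun h => `[< P h >].

Fact subalg_pred_closed : GRing.subalg_closed subalg_pred.
Proof.
split=> [|k g h|g h].
- exact/asboolP.
- by move=> /asboolP Pg /asboolP Ph; apply/asboolP/PL.
- by move=> /asboolP Pg /asboolP Ph; apply/asboolP/PM.
Qed.

HB.instance Definition _ :=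
  GRing.isSubalgClosed.Build F H subalg_pred subalg_pred_closed.

Record subalg := Subalg {subalg_val : H; _ : subalg_val \in subalg_pred}.
HB.instance Definition _ := [isSub for subalg_val].
HB.instance Definition _ := [Choice of subalg by <:].
HB.instance Definition _ := [SubChoice_isSubAlgebra of subalg by <:].

Variables (p : nat) (q : F) (m : nat) (a x y : H).
Hypothesis book : book_presentation p q m a x y.

(* Composing the map from [H] to the subalgebra given by universality with the
   inclusion fixes the generators, so it is the identity. *)
Lemma book_ind : P a -> P x -> P y -> forall h, P h.
Proof.
move=> Pa Px Py h; have [rel univ uniq] := book.
pose a' := Subalg (introT (asboolP _) Pa).
pose x' := Subalg (introT (asboolP _) Px).
pose y' := Subalg (introT (asboolP _) Py).
have [|f [fa fx fy]] := univ subalg a' x' y'.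
  case: rel => axa aya [ap xp yp xy].
  have valX (z : subalg) k : val (z ^+ k) = val z ^+ k.
    exact: (rmorphXn (val : subalg -> H)).
  by split; [| |split]; apply/val_inj; rewrite /= ?valX.
pose valf : {lrmorphism H -> H} :=
  HB.pack_for {lrmorphism H -> H} ((val : subalg -> H) \o f).
have fK := uniq H valf idfun.
have <- : subalg_val (f h) = h by apply: fK; rewrite /= ?fa ?fx ?fy.
by case: (f h) => h' /= /asboolP.
Qed.
End Subalgebra.

Lemma qcommuteX (F : fieldType) (A : algType F) (q : F) (g X : A) k :
  g * X = q *: (X * g) -> g ^+ k * X = q ^+ k *: (X * g ^+ k).
Proof.
move=> gX; elim: k => [|k IH]; first by rewrite !expr0 mul1r mulr1 scale1r.
rewrite exprS -mulrA IH -scalerAr (mulrA g) gX -scalerAl scalerA -mulrA.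
by rewrite exprSr.
Qed.

Lemma qcommuteXr (F : fieldType) (A : algType F) (q : F) (g X : A) k :
  g * X = q *: (X * g) -> g * X ^+ k = q ^+ k *: (X ^+ k * g).
Proof.
move=> gX; elim: k => [|k IH]; first by rewrite !expr0 mul1r mulr1 scale1r.
rewrite exprS mulrA gX -scalerAl -(mulrA X g) IH -scalerAr scalerA mulrA.
by rewrite exprS.
Qed.

(** * Linear maps on the presented algebra with prescribed values *)

Section Functionals.
Variables (F : fieldType) (p : nat) (q : F) (m : nat) (H : algType F).
Variables (a x y : H).
Hypotheses (p_gt1 : (1 < p)%N) (q_prim : p.-primitive_root q).
Hypothesis book : book_presentation p q m a x y.

Let p_gt0 : (0 < p)%N := ltnW p_gt1.
Let predpK : p.-1.+1 = p := prednK p_gt0.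
Let expr0p (R : pzSemiRingType) : 0 ^+ p = 0 :> R.
Proof. by rewrite expr0n gtn_eqF. Qed.

Lemma book_character (z : F) : z ^+ p = 1 ->
  exists f : {linear H -> F^o},
    [/\ forall i, f (a ^+ i) = z ^+ i, f x = 0 & f y = 0].
Proof.
move=> zp; have [_ univ _] := book.
have [|f [fa fx fy]] := univ F^o z 0 0; last first.
  by exists f; split=> //= i; rewrite rmorphXn /= fa.
split; rewrite ?mulr0 ?mul0r ?scaler0 //.
by split; rewrite ?expr0p ?mulr0 ?subrr.
Qed.

(* Finite Fourier inversion on the powers of [a]. *)
Lemma book_functional_powers (V : lmodType F) (c : nat -> V) :
  exists w : {linear H -> V},
    [/\ forall i, (i < p)%N -> w (a ^+ i) = c i, w x = 0 & w y = 0].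
Proof.
have /fin_all_exists[chi chiP] (j : 'I_p) : exists f : {linear H -> F^o},
    [/\ forall i, f (a ^+ i) = (q ^+ j) ^+ i, f x = 0 & f y = 0].
  by apply: book_character; rewrite exprAC (prim_expr_order q_prim) expr1n.
pose w h := \sum_(i < p) \sum_(j < p)
  (p%:R^-1 * ((q ^+ j) ^- i * chi j h)) *: c i.
have lw : linear w.
  move=> k g h; rewrite /w scaler_sumr -big_split; apply: eq_bigr => i _ /=.
  rewrite scaler_sumr -big_split; apply: eq_bigr => j _ /=.
  by rewrite linearP scalerA -scalerDl; congr (_ *: _);
    rewrite /GRing.scale /=; ring.
have [w' w'E] := linear_exists lw; exists w'; split; last 2 first.
- rewrite w'E /w big1 // => i _; rewrite big1 // => j _.
  by have [_ -> _] := chiP j; rewrite !mulr0 scale0r.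
- rewrite w'E /w big1 // => i _; rewrite big1 // => j _.
  by have [_ _ ->] := chiP j; rewrite !mulr0 scale0r.
move=> i ip; rewrite w'E /w (bigD1 (Ordinal ip)) //= [X in _ + X]big1.
  rewrite addr0 -scaler_suml -[RHS]scale1r; congr (_ *: _).
  rewrite -mulr_sumr.
  under eq_bigr => j _.
    have [-> _ _] := chiP j; rewrite mulVf; last first.
      by rewrite !expf_neq0 // (prim_root_eq0 q_prim) gtn_eqF.
    over.
  by rewrite sumr_const card_ord mulVf // (prim_root_natf_neq0 q_prim).
move=> k nki; rewrite -scaler_suml -mulr_sumr.
have -> : \sum_(j < p) (q ^+ j) ^- k * chi j (a ^+ i) = 0; last first.
  by rewrite mulr0 scale0r.
(* This is [q] to the power [i - k]: it differs from 1 and its [p]-th power is 1, so its geometric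
   sum vanishes. *)
pose z := q ^+ i / q ^+ k.
transitivity (\sum_(j < p) z ^+ j).
  apply: eq_bigr => j _; have [-> _ _] := chiP j.
  by rewrite mulrC exprMn exprVn -!exprM ![(j * _)%N]mulnC.
have qk0 : q ^+ k != 0.
  by rewrite expf_neq0 // (prim_root_eq0 q_prim) gtn_eqF.
have z1 : z - 1 != 0.
  rewrite subr_eq0; apply: contra nki => /eqP zE.
  have : q ^+ i == q ^+ k by rewrite -[q ^+ i](divfK qk0) -/z zE mul1r.
  rewrite (eq_prim_root_expr q_prim) !modn_small // => /eqP ik.
  by apply/eqP/val_inj; rewrite /= ik.
apply: (mulfI z1); rewrite -subrX1 mulr0 exprMn exprVn.
by rewrite -!exprM ![(_ * p)%N]mulnC !exprM (prim_expr_order q_prim) !expr1n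
  divr1 subrr.
Qed.

(** With [D z = diag(z, 1)], sending [a] to [D q], [x] to [N] and [y] to 0 defines a representation
    whose [(0, 1)] entry is 1 at [x] and 0 at [y] and the powers of [a]. With [D (q ^+ m)] the roles
    of [x] and [y] are exchanged. *)
Let N : 'M[F]_2 := delta_mx 0 1.
Let D z : 'M[F]_2 := z *: delta_mx 0 0 + delta_mx 1 1.

Let NN : N * N = 0. Proof. by rewrite -[_ * _]/(_ *m _) mul_delta_mx_0. Qed.

Let DN z : D z * N = z *: N.
Proof.
rewrite mulrDl -scalerAl -![_ * _]/(_ *m _) mul_delta_mx.
by rewrite mul_delta_mx_0 // addr0.
Qed.

Let ND z k : N * D z ^+ k = N.
Proof.
elim: k => [|k IH]; first by rewrite mulr1.
rewrite exprSr mulrA IH mulrDr -scalerAr -![_ * _]/(_ *m _) mul_delta_mx.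
by rewrite mul_delta_mx_0 // scaler0 add0r.
Qed.

Let DX z k : D z ^+ k = D (z ^+ k).
Proof.
elim: k => [|k IH].
  rewrite !expr0 /D scale1r; apply/matrixP=> i j; rewrite !mxE.
  by case: i j => [[|[|i]] ?] // [[|[|j]] ?] //=; rewrite ?addr0 ?add0r.
rewrite exprS IH /D mulrDl !mulrDr -!scalerAl -!scalerAr -![_ * _]/(_ *m _).
by rewrite !mul_delta_mx !mul_delta_mx_0 // !scaler0 addr0 add0r scalerA exprS.
Qed.

Let N0p : N ^+ p = 0.
Proof. by rewrite -(subnKC p_gt1) exprD expr2 NN mul0r. Qed.

Lemma book_functional_x (V : lmodType F) (v : V) :
  exists w : {linear H -> V}, [/\ forall i, w (a ^+ i) = 0, w x = v & w y = 0].
Proof.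
have [_ univ _] := book.
have [|f [fa fx fy]] := univ 'M[F]_2 (D q) N 0.
  split; rewrite ?mulr0 ?mul0r ?scaler0 //; last split.
  - by rewrite DN -scalerAl ND.
  - by rewrite DX (prim_expr_order q_prim) -(DX 1 0).
  - exact: N0p.
  - exact: expr0p.
  - by rewrite subrr.
have lw : linear (fun h => f h 0 1 *: v).
  by move=> k g h; rewrite linearP !mxE scalerDl scalerA.
have [w wE] := linear_exists lw; exists w; split=> [i||]; rewrite wE.
- by rewrite rmorphXn /= fa DX !mxE /= mulr0 addr0 scale0r.
- by rewrite fx !mxE scale1r.
- by rewrite fy mxE scale0r.
Qed.

Lemma book_functional_y (V : lmodType F) (v : V) :
  exists w : {linear H -> V}, [/\ forall i, w (a ^+ i) = 0, w x = 0 & w y = v].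
Proof.
have [_ univ _] := book.
have [|f [fa fx fy]] := univ 'M[F]_2 (D (q ^+ m)) 0 N.
  split; rewrite ?mulr0 ?mul0r ?scaler0 //; last split.
  - by rewrite DN -scalerAl ND.
  - by rewrite DX exprAC (prim_expr_order q_prim) expr1n -(DX 1 0).
  - exact: expr0p.
  - exact: N0p.
  - by rewrite subrr.
have lw : linear (fun h => f h 0 1 *: v).
  by move=> k g h; rewrite linearP !mxE scalerDl scalerA.
have [w wE] := linear_exists lw; exists w; split=> [i||]; rewrite wE.
- by rewrite rmorphXn /= fa DX !mxE /= mulr0 addr0 scale0r.
- by rewrite fx mxE scale0r.
- by rewrite fy !mxE scale1r.
Qed.

Lemma book_linear_map (V : lmodType F) (c : nat -> V) (vx vy : V) :
  exists w : {linear H -> V},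
    [/\ forall i, (i < p)%N -> w (a ^+ i) = c i, w x = vx & w y = vy].
Proof.
have [w1 [w1a w1x w1y]] := book_functional_powers c.
have [w2 [w2a w2x w2y]] := book_functional_x vx.
have [w3 [w3a w3x w3y]] := book_functional_y vy.
exists (w1 \+ (w2 \+ w3)); split=> [i ip||] /=.
- by rewrite w1a // w2a w3a !addr0.
- by rewrite w1x w2x w3x add0r addr0.
- by rewrite w1y w2y w3y !add0r.
Qed.

Let ax : a * x = q *: (x * a).
Proof.
have [[axa _ [ap _ _ _]] _ _] := book.
by rewrite scalerAl -axa -(mulrA (a * x)) -exprSr predpK ap mulr1.
Qed.

Let ay : a * y = q ^+ m *: (y * a).
Proof.
have [[_ aya [ap _ _ _]] _ _] := book.
by rewrite scalerAl -aya -(mulrA (a * y)) -exprSr predpK ap mulr1.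
Qed.

Let xy : x * y = y * x.
Proof.
by have [[_ _ [_ _ _ xy0]] _ _] := book; apply/eqP; rewrite -subr_eq0 xy0.
Qed.

(* Dual form of: the monomials [x ^+ j * y ^+ k * a ^+ i] span [H]. *)
Lemma book_span (V : lmodType F) (f : H -> V) : linear f ->
  (forall j k i, f (x ^+ j * y ^+ k * a ^+ i) = 0) -> f =1 (fun=> 0).
Proof.
move=> lf f0 h; rewrite -[h]mulr1.
(* Dually, left multiplication by [h] preserves the span of the monomials. The map [f] is quantified
   inside [P], since the product case applies the hypothesis on [h] to [f (g * _)]. *)
pose P h := forall f : H -> V, linear f ->
  (forall j k i, f (x ^+ j * y ^+ k * a ^+ i) = 0) ->
  forall j k i, f (h * (x ^+ j * y ^+ k * a ^+ i)) = 0.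
suff Ph : P h by have := Ph f lf f0 0 0 0; rewrite !expr0 !mulr1.
apply: (book_ind _ _ _ book) => {h lf f0 f} [|l g h Pg Ph|g h Pg Ph|||] f lf
  f0 j k i.
- by rewrite mul1r.
- by rewrite mulrDl -scalerAl lf (Pg f) // (Ph f) // scaler0 addr0.
- rewrite -mulrA (Ph (fun h => f (g * h))) // => [c s t|? ? ?]; last exact: Pg.
  by rewrite mulrDr -scalerAr lf.
- have -> : a * (x ^+ j * y ^+ k * a ^+ i) =
            (q ^+ j * (q ^+ m) ^+ k) *: (x ^+ j * y ^+ k * a ^+ i.+1).
    rewrite !mulrA (qcommuteXr _ ax) -!scalerAl -(mulrA _ a) (qcommuteXr _ ay).
    by rewrite -scalerAr -scalerAl scalerA -!mulrA -exprS.
  by rewrite (linear_scale lf) f0 scaler0.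
- by rewrite !mulrA -exprS f0.
- rewrite !mulrA; have -> : y * x ^+ j = x ^+ j * y by apply: commrX;
    rewrite /GRing.comm xy.
  by rewrite -(mulrA _ y) -exprS f0.
Qed.

End Functionals.

(** * Words in the generators, their degrees and their coproducts *)

Section Words.
Variables (F : fieldType) (H : algType F) (a x y : H).

(** The index counts the letters [x] and [y]. As a relation it avoids constructing a grading of [H]:
    one element may be a word of several degrees. *)
Inductive word : nat -> H -> Prop :=
| Word1 : word 0 1
| Worda d w of word d w : word d (a * w)
| Wordx d w of word d w : word d.+1 (x * w)
| Wordy d w of word d w : word d.+1 (y * w).

Lemma word_aX d w k : word d w -> word d (a ^+ k * w).
Proof.
move=> dw; elim: k => [|k IH]; first by rewrite mul1r.
by rewrite exprS -mulrA; apply: Worda.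
Qed.

Lemma word0 w : word 0 w -> exists k, w = a ^+ k.
Proof.
move dE: 0%N => d dw; elim: dw dE => [|{}d w' _ IH|//|//] dE;
  first by exists 0%N.
by have [k ->] := IH dE; exists k.+1; rewrite exprS.
Qed.

Lemma word_monomial j k i : word (j + k) (x ^+ j * y ^+ k * a ^+ i).
Proof.
elim: j => [|j IH]; last by rewrite exprS -!mulrA; apply: Wordx; rewrite mulrA.
rewrite mul1r; elim: k => [|k IH]; last by rewrite exprS -mulrA; apply: Wordy.
by rewrite mul1r -[a ^+ i]mulr1; apply/word_aX/Word1.
Qed.

Variables (hH : hopf H) (m : nat).
Hypotheses (coprod_a : tensor_eq (coprod hH a) [:: (a, a)])
           (coprod_x : tensor_eq (coprod hH x) [:: (x, a); (1, x)])
           (coprod_y : tensor_eq (coprod hH y) [:: (y, 1); (a ^+ m, y)]).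

Lemma sweedler_aX (V : lmodType F) (f : H -> H -> V) k : is_bilinear f ->
  sweedler hH f (a ^+ k) = f (a ^+ k) (a ^+ k).
Proof.
elim: k f => [|k IH] f bf; first by rewrite expr0 sweedler1.
rewrite exprS sweedlerM // (sweedler_eq (sweedlerMl _ _ bf) coprod_a) big_seq1
  /=.
by rewrite (IH (fun s t => f (a * s) (a * t))) //; apply: is_bilinear_mul.
Qed.

(* Dual form of: the coproduct of a word is a sum of tensors of words whose
   degrees add up. *)
Lemma sweedler_word (V : lmodType F) (f : H -> H -> V) d w :
    word d w -> is_bilinear f ->
    (forall d1 d2 s t, word d1 s -> word d2 t ->
      (d1 + d2)%N = d -> f s t = 0) ->
  sweedler hH f w = 0.
Proof.
move=> dw; elim: dw f => {d w} [|d w dw IH|d w dw IH|d w dw IH] f bf f0.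
- by rewrite sweedler1 //; apply: (f0 0%N 0%N) => //; apply: Word1.
- rewrite sweedlerM // (sweedler_eq (sweedlerMl _ _ bf) coprod_a) big_seq1 /=.
  apply: (IH (fun s t => f (a * s) (a * t))) => [|d1 d2 s t d1s d2t E].
    exact: is_bilinear_mul.
  by apply: (f0 d1 d2) => //; apply: Worda.
- rewrite sweedlerM // (sweedler_eq (sweedlerMl _ _ bf) coprod_x) big_cons
    big_seq1 /=.
  have -> : sweedler hH (fun s t => f (x * s) (a * t)) w = 0.
    apply: IH => [|d1 d2 s t d1s d2t E]; first exact: is_bilinear_mul.
    by apply: (f0 d1.+1 d2); rewrite ?addSn ?E //;
      [apply: Wordx | apply: Worda].
  rewrite add0r; apply: IH => [|d1 d2 s t d1s d2t E];
    first exact: is_bilinear_mul.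
  by rewrite mul1r; apply: (f0 d1 d2.+1); rewrite ?addnS ?E //; apply: Wordx.
- rewrite sweedlerM // (sweedler_eq (sweedlerMl _ _ bf) coprod_y) big_cons
    big_seq1 /=.
  have -> : sweedler hH (fun s t => f (y * s) (1 * t)) w = 0.
    apply: IH => [|d1 d2 s t d1s d2t E]; first exact: is_bilinear_mul.
    by rewrite mul1r; apply: (f0 d1.+1 d2); rewrite ?addSn ?E //; apply: Wordy.
  rewrite add0r; apply: IH => [|d1 d2 s t d1s d2t E];
    first exact: is_bilinear_mul.
  apply: (f0 d1 d2.+1); rewrite ?addnS ?E //; last exact: Wordy.
  exact: word_aX.
Qed.

End Words.

(** * Convolution invertibility *)

Section ConvolutionInverse.
Variables (F : fieldType) (p : nat) (q : F) (m : nat) (H : algType F).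
Variables (hH : hopf H) (a x y : H).
Hypotheses (p_gt1 : (1 < p)%N) (q_prim : p.-primitive_root q).
Hypothesis book : book_hopf p q m hH a x y.
Variable A : unitAlgType F.
Implicit Types f : H -> A.

Local Notation word := (word a x y).
Local Notation unit := (@conv_unit F H hH A).

Let pres : book_presentation p q m a x y. Proof. by case: book. Qed.

Lemma book_expa k : a ^+ k = a ^+ (k %% p).
Proof.
have [[_ _ [ap _ _ _]] _ _] := pres.
by rewrite {1}(divn_eq k p) exprD mulnC exprM ap expr1n mul1r.
Qed.

Lemma conv_aX (f g : H -> A) k : linear f -> linear g ->
  conv hH f g (a ^+ k) = f (a ^+ k) * g (a ^+ k).
Proof.
move=> lf lg; have [_ [ca _ _]] := book.
by rewrite conv_sweedler (sweedler_aX ca) //; apply: conv_bilinear.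
Qed.

Lemma unit_aX k : unit (a ^+ k) = 1.
Proof.
have [_ [ca _ _]] := book; have [[_ _ [ap _ _ _]] _ _] := pres.
(* The counit axiom gives [counit hH a *: a = a], and [a] is invertible. *)
have ca1 : counit hH a = 1.
  have b : is_bilinear (fun s t : H => counit hH s *: t).
    split=> z k' s t; first by rewrite linearP scalerDl scalerA.
    by rewrite scalerDr !scalerA mulrC.
  have := sweedler_eq b ca; rewrite big_seq1 /sweedler counitl /=.
  move/(congr1 ( *%R^~ (a ^+ p.-1))); rewrite -scalerAl -exprS.
  rewrite prednK ?(ltnW p_gt1) // ap => /eqP.
  rewrite -subr_eq0 -[X in X - _]scale1r -scalerBl scaler_eq0 oner_eq0 orbF.
  by rewrite subr_eq0 => /eqP.
by rewrite /conv_unit rmorphXn /= ca1 expr1n scale1r.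
Qed.

(** If [d1 + d2 <= k], then either [d2 = 0] and [g] vanishes on the second leg, or [d1 < k] and [f]
    vanishes on the first. *)
Lemma conv_word_vanish (f g : H -> A) k : linear f -> linear g ->
    (forall w, word 0 w -> g w = 0) ->
    (forall d w, (d < k)%N -> word d w -> f w = 0) ->
  forall d w, (d < k.+1)%N -> word d w -> conv hH f g w = 0.
Proof.
move=> lf lg g0 f0 d w dk dw; have [_ [ca cx cy]] := book.
rewrite conv_sweedler (sweedler_word ca cx cy dw) //;
  first exact: conv_bilinear.
move=> d1 [|d2] s t d1s d2t E; first by rewrite (g0 t) ?mulr0.
rewrite (f0 d1 s) ?mul0r //; rewrite ltnS in dk; apply: leq_trans dk.
by rewrite -E addnS ltnS leq_addr.
Qed.

(** The monomials with an exponent of [x] or [y] at least [p] are zero, and the others have degree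
    below [p + p]. *)
Lemma word_eq0 f : linear f ->
  (forall d w, (d < p + p)%N -> word d w -> f w = 0) -> f =1 (fun=> 0).
Proof.
move=> lf f0; have [[_ _ [ap xp yp _]] _ _] := pres.
apply: (book_span p_gt1 pres) => // j k i.
have [jp|pj] := ltnP j p; last first.
  by rewrite -(subnKC pj) exprD xp !mul0r linear_zero.
have [kp|pk] := ltnP k p; last first.
  by rewrite -(subnKC pk) exprD yp !(mul0r, mulr0) linear_zero.
apply: (f0 (j + k)%N); last exact: word_monomial.
by rewrite -addSn leq_add // ltnW.
Qed.

(* Newton's iteration [s + (1 - s * f)] for the left inverse: the error term is
   multiplied by [1 - f] at each step, hence vanishes on words of growing
   degree. *)
Lemma conv_unipotent_left_inverse f : linear f ->
    (forall k, f (a ^+ k) = 1) ->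
  exists2 s, linear s & conv hH s f =1 unit.
Proof.
move=> lf f1.
have lunit := @conv_unit_linear F H hH A.
have lB (g h : H -> A) : linear g -> linear h -> linear (fun w => g w - h w).
  by move=> lg lh k s t; rewrite lg lh scalerBr opprD addrACA.
have lD (g h : H -> A) : linear g -> linear h -> linear (fun w => g w + h w).
  by move=> lg lh k s t; rewrite lg lh scalerDr addrACA.
suff [s ls sf] : exists2 s, linear s & forall d w, (d < p + p)%N -> word d w ->
    unit w - conv hH s f w = 0.
  exists s => // h; apply/esym/eqP; rewrite -subr_eq0; apply/eqP.
  exact: (word_eq0 (lB _ _ lunit (conv_linear hH ls lf)) sf).
elim: (p + p)%N => [|k [s ls sf]].
  by exists (fun=> 0) => [k s t|//]; rewrite scaler0 addr0.
pose r h := unit h - conv hH s f h.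
have lr : linear r by apply: lB => //; apply: conv_linear.
exists (fun h => s h + r h) => [|d w dk dw]; first exact: lD.
transitivity (conv hH r (fun h => unit h - f h) w).
  transitivity (r w - conv hH r f w).
    rewrite /r -addrA -opprD; congr (_ - _).
    by rewrite -big_split; apply: eq_bigr => z _; rewrite mulrDl.
  rewrite -[in LHS](convu1 hH lr) -sumrB.
  by apply: eq_bigr => z _; rewrite mulrBr.
apply: (conv_word_vanish lr (lB _ _ lunit lf) _ sf dk dw) => w' /word0[i ->].
by rewrite unit_aX f1 subrr.
Qed.

Lemma conv_left_inverse f : linear f ->
    (forall k, f (a ^+ k) \is a GRing.unit) ->
  exists2 s, linear s & conv hH s f =1 unit.
Proof.
move=> lf fU.
(* Convolving with [w] normalizes the values of [f] at the powers of [a] to 1, which reduces to the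
   unipotent case. *)
have [w [wa _ _]] := book_linear_map p_gt1 q_prim pres (fun i => (f
  (a ^+ i))^-1) 0 0.
have lw : linear w by move=> k g h; rewrite linearP.
have [|k|s ls sE] := @conv_unipotent_left_inverse (conv hH w f).
- exact: conv_linear.
- rewrite conv_aX // book_expa wa ?ltn_pmod ?(ltnW p_gt1) // mulVr //.
- exists (conv hH s w); first exact: conv_linear.
  by move=> h; rewrite convA.
Qed.

(** A left inverse [v] of [f] also takes unit values at the powers of [a], so it has a left inverse
    [w]. Associativity gives [f = w], which makes [v] two-sided. *)
Lemma conv_inverse_exists f : linear f ->
    (forall k, f (a ^+ k) \is a GRing.unit) ->
  exists2 v : H -> A, linear v & conv hH f v =1 unit /\ conv hH v f =1 unit.
Proof.
move=> lf fU; have [v lv vf] := conv_left_inverse lf fU.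
have vU k : v (a ^+ k) \is a GRing.unit.
  have := vf (a ^+ k); rewrite conv_aX // unit_aX => /(canRL (mulrK (fU k))) ->.
  by rewrite mul1r unitrV.
have [w lw wv] := conv_left_inverse lv vU.
exists v => //; split=> // h.
have fw : f =1 w.
  move=> h'; rewrite -(conv1u hH lf) -(eq_conv hH wv (fun=> erefl)) convA //.
  by rewrite (eq_conv hH (fun=> erefl) vf) convu1.
by rewrite (eq_conv hH fw (fun=> erefl)).
Qed.

End ConvolutionInverse.

(** * Implementing the generators by [g], [X], [Y] and extending them to [u] *)

Theorem proposition8p2 (F : fieldType) (p : nat) (q : F) (m : nat)
    (p_prime : prime p) (p_odd : odd p) (q_prim : p.-primitive_root q)
    (m_range : (1 <= m <= p.-1)%N)
    (H : algType F) (hH : hopf H) (a x y : H)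
    (book : book_hopf p q m hH a x y)
    (n : nat) (act : {bilinear H -> 'M[F]_n.+1 -> 'M[F]_n.+1})
    (act_alg : module_algebra hH act) :
  exists u : {linear H -> 'M[F]_n.+1},
    [/\ inner_via hH act u,
        u a \is a GRing.unit,
        forall b : 'M[F]_n.+1,
          [/\ act a b = u a * b * (u a)^-1,
              act x b = u x * b * (u a)^-1 - b * u x * (u a)^-1
            & act y b = u y * b - u a ^+ m * b * u a ^- m * u y]
      & exists theta tau mu nu : F,
          [/\ theta != 0, u a ^+ p = theta%:M,
              u a * u x = q *: (u x * u a),
              u a * u y = q ^+ m *: (u y * u a)
            & [/\ u x ^+ p = mu%:M, u y ^+ p = nu%:M
                & u x * u y - u y * u x = tau *: u a ^+ m]]].
Proof.
have p_gt1 := prime_gt1 p_prime; have p_gt0 := prime_gt0 p_prime.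
have [pres [ca cx cy]] := book.
have [[axa aya [ap xp yp xy0]] _ _] := pres.
have [act1 actM actu actD] := act_alg.
have m_lt_p : (m < p)%N by case/andP: m_range => _; rewrite -ltnS prednK.
have m_gt0 : (0 < m)%N by case/andP: m_range.
have coprime_m : coprime m p.
  by rewrite coprime_sym prime_coprime // gtnNdvd.
have q1 : q != 1.
  by rewrite -(expr1 q) -(prim_order_dvd q_prim) dvdn1 neq_ltn p_gt1 orbT.
have qm1 : q ^+ m != 1 by rewrite -(prim_order_dvd q_prim) gtnNdvd.
have q0 : q != 0 by rewrite (prim_root_eq0 q_prim) gtn_eqF.
have ax : a * x = q *: (x * a).
  by rewrite scalerAl -axa -(mulrA (a * x)) -exprSr prednK // ap mulr1.
have ay : a * y = q ^+ m *: (y * a).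
  by rewrite scalerAl -aya -(mulrA (a * y)) -exprSr prednK // ap mulr1.
have lactl b : linear (act^~ b) by move=> k g h; rewrite linearPl.
have lactr h : linear (act h) by move=> k b c; rewrite linearPr.
have bact b c : is_bilinear (fun s t => act s b * act t c).
  by apply: conv_bilinear.
have actX h k b : act (h ^+ k) b = iter k (act h) b.
  by elim: k => [|k IH]; rewrite ?act1 //= -IH exprS actM.
have actaD b c : act a (b * c) = act a b * act a c.
  by rewrite actD [LHS](sweedler_eq (bact b c) ca) big_seq1.
have actxD b c : act x (b * c) = act x b * act a c + b * act x c.
  by rewrite actD [LHS](sweedler_eq (bact b c) cx) big_cons big_seq1 /= act1.
have actyD b c : act y (b * c) = act y b * c + act (a ^+ m) b * act y c.
  by rewrite actD [LHS](sweedler_eq (bact b c) cy) big_cons big_seq1 /= act1.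
have acta1 : act a 1 = 1.
  by have := unit_aX p_gt1 book 'M[F]_n.+1 1; rewrite expr1 actu.
have [g gU actg] := automorphism_inner (lactr a) acta1 actaD.
have actaX k b : act (a ^+ k) b = g ^+ k * b * g ^- k.
  rewrite actX; elim: k => [|k IH] /=; first by rewrite expr0 invr1 mul1r mulr1.
  by rewrite IH actg exprS invrM ?unitrX // !mulrA.
have actax b : act a (act x b) = q *: act x (act a b).
  by rewrite -!actM ax (linear_scale (lactl b)).
have actay b : act a (act y b) = q ^+ m *: act y (act a b).
  by rewrite -!actM ay (linear_scale (lactl b)).
have [X actX' gX] := skew_derivationr_inner gU actg (lactr x) q1 actxD actax.
have gmU : g ^+ m \is a GRing.unit by rewrite unitrX.
have [||Y actY gY] := skew_derivationl_inner gU actg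
  (lactr y) gmU _ qm1 _ actay.
- by rewrite -exprS -exprSr.
- by move=> b c; rewrite actyD actaX.
have hX := qcommuteX m gX; have hY := qcommuteX m gY.
have gpC b : g ^+ p * b = b * g ^+ p.
  by rewrite -{2}[b]act1 -ap actaX mulrVK ?unitrX.
have [theta thetaE] := central_scalar gpC.
have [mu muE] : exists mu, X ^+ p = mu%:M.
  apply/central_scalar/(skew_commutatorr_power p_odd q_prim gU gX) => b.
  rewrite -(eq_iter actX') -actX xp.
  by rewrite (linear_zero (lactl b)).
have [nu nuE] : exists nu, Y ^+ p = nu%:M.
  apply/central_scalar/(skew_commutatorl_power p_odd _ gmU _ hY) => [|b|b].
  (* Moving [g ^+ m] past [Y] costs [q ^+ (m * m)], still a primitive [p]-th root of unity because
     [m] is coprime to [p]. *)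
  - by rewrite -exprM (prim_root_exp_coprime _ q_prim) coprimeMl coprime_m.
  - by rewrite exprAC; apply/esym/commrX; rewrite /GRing.comm gpC.
  - by rewrite -(eq_iter actY) -actX yp (linear_zero (lactl b)).
(* Here [h = g ^+ m] and the common factor is [r = q ^+ m], for [g] past [Y] as for [g ^+ m] past
   [X]. *)
have [tau tauE] : exists tau, g ^- m * (X * Y - Y * X) = tau%:M.
  apply/central_scalar/(skew_commutators gU _ gmU gY hX).
  - by rewrite expf_neq0.
  - by rewrite -exprS -exprSr.
  - move=> b; rewrite -actY -!actX' -actY -!actM.
    by congr (act _ b); apply/eqP; rewrite -subr_eq0 xy0.
(* At the prescribed values the intertwining relation restates the formulas for the action of the
   generators, so [intertwiner_id] carries these values over to [u]. *)
have [u0 [u0a u0x u0y]] := book_linear_map p_gt1 q_prim pres (fun i =>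
  g ^+ i) X Y.
have lu0 : linear u0 by move=> k s t; rewrite linearP.
have bu0 b : is_bilinear (fun s t => act s b * u0 t) by apply: conv_bilinear.
have [u uE] := linear_exists (intertwiner_linear hH act lu0).
have ua i : (i < p)%N -> u (a ^+ i) = g ^+ i.
  move=> ip; rewrite uE intertwiner_id ?u0a // => b.
  by rewrite (sweedler_aX ca) // u0a // actaX mulrVK ?unitrX.
have u1 : u 1 = 1 by have := ua 0 p_gt0; rewrite !expr0.
have ua1 : u a = g by have := ua 1 p_gt1; rewrite !expr1.
have ux : u x = X.
  rewrite uE intertwiner_id // => b.
  rewrite (sweedler_eq (bu0 b) cx) big_cons big_seq1 /= act1 u0x.
  have -> : u0 a = g by have := u0a 1 p_gt1; rewrite !expr1.
  by rewrite actX' -mulrBl mulrVK // subrK.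
have uy : u y = Y.
  rewrite uE intertwiner_id // => b.
  rewrite (sweedler_eq (bu0 b) cy) big_cons big_seq1 /= u0y.
  have -> : u0 1 = 1 by have := u0a 0 p_gt0; rewrite !expr0.
  by rewrite mulr1 actY actaX subrK.
have lu : linear u by move=> k s t; rewrite linearP.
have [v lv [uv vu]] : exists2 v : H -> 'M[F]_n.+1, linear v &
    conv hH u v =1 conv_unit hH _ /\ conv hH v u =1 conv_unit hH _.
  apply: (conv_inverse_exists p_gt1 q_prim book lu) => k.
  by rewrite (book_expa book) ua ?ltn_pmod // unitrX.
have [v' v'E] := linear_exists lv.
exists u; rewrite ua1 ux uy; split=> //; last first.
  exists theta, tau, mu, nu; split=> //; last split=> //.
    apply: contraTneq (unitrX p gU) => theta0.
    by rewrite thetaE theta0 raddf0 unitr0.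
  by rewrite -[LHS](mulVKr gmU) tauE -scalemx1 -scalerAr mulr1.
split=> //; exists v'; split.
  split=> h; [rewrite -[RHS]uv | rewrite -[RHS]vu].
    exact: eq_conv.
  exact: eq_conv.
move=> h b; under eq_bigr do rewrite v'E.
apply: (intertwiner_inner lu lv _ uv).
move=> h' b'; rewrite uE (intertwinerE act_alg lu0).
by apply: eq_bigr => z _; rewrite uE.
Qed.
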